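(* Let $P(k)=22k^2-92k+11$. Then $$\sum_{k=1}^\infty \frac{\binom{4k}{k}}{16^k}\left(P(k)H_{k}-54k+108-\frac{10}{3k}\right)=-\frac{20}{3}\log 2,$$ $$\sum_{k=1}^\infty \frac{\binom{4k}{k}}{16^k}\left(P(k)H_{2k}+287k-115-\frac{25}{6k}\right)=214-\frac{40}{3}\log 2,$$ $$\sum_{k=1}^\infty \frac{\binom{4k}{k}}{16^k}\left(P(k)H_{3k}-296k+178-\frac{25}{3k}\right)=-196-\frac{80}{3}\log 2,$$ $$\sum_{k=1}^\infty \frac{\binom{4k}{k}}{16^k}\left(P(k)H_{4k}-\frac{449k-275}{2}-\frac{85}{12k}\right)=-151-\frac{80}{3}\log 2.$$
   Context: For $n\in\{0,1,2,\ldots\}$, $H_n=\sum_{0<k\le n}\frac1k$ denotes the $n$-th harmonic number (so $H_0=0$). $\log$ is the natural logarithm. *)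

(* Defs.v *)
From Stdlib Require Import Reals.
From Coquelicot Require Import Coquelicot.
Open Scope R_scope.

Definition harmonic (n : nat) : R := sum_n_m (fun k => / INR k) 1 n.

Definition P (x : R) : R := 22 * x ^ 2 - 92 * x + 11.

(* [Binomial.C] must be qualified: Coquelicot shadows [C] with the complex
   numbers. *)
Definition weight (k : nat) : R := Binomial.C (4 * k) k / 16 ^ k.

(* Coquelicot's series start at index 0; these start at index 1. *)
Definition is_series_from_1 (a : nat -> R) (l : R) : Prop :=
  is_series (fun n => a (S n)) l.

(* Main.v *)
Require Import Defs.
From Stdlib Require Import Reals Arith Lra Lia.
From Coquelicot Require Import Coquelicot.
Open Scope R_scope.

(** Write [c_k] for the binomial coefficient [4k choose k] and put
    [x = z (1 - z)^3].  Then [sum c_k x^k = 1 / (1 - 4z)] for small [z >= 0]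
    ([is_series_binom4]), an instance of Lagrange inversion, proved here by
    reading the sum as the expected number of visits of a random walk to its
    starting point.  Applying [x d/dx], which is
    [z (1 - z) / (1 - 4z) d/dz], one gets the sums with weights [k] and [k^2],
    and dividing by [x] and integrating gives [sum c_k x^k / k = - 4 ln (1 - z)].
    Hence [sum P(k) c_k x^k] is an explicit rational function [g(z)]
    ([is_series_coef]).

    Let [s] be the reciprocal of the tribonacci constant, the real root of
    [s^3 + s^2 + s = 1].  The value [x = 1/16] corresponds to [z = s^3 / 2].
    The point of the polynomial [P] is that [g = - 5] there: the numerator of
    [g + 5] is divisible by the minimal polynomial of [s^3 / 2].

    For the harmonic numbers, [H_n] is the integral of [(1 - u^n) / (1 - u)]
    over [0 <= u <= 1], so that [sum P(k) c_k 16^-k H_(mk)] is the integral of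
    [(- 5 - g(z)) / (1 - u)] along [u^m = 16 z (1 - z)^3]
    ([is_series_coef_harmonic]).  For [m = 1, 2, 3, 4] the curve has a rational
    parametrization:
    [z = r] and [u = 16 r (1 - r)^3];
    [z = r^2 / (1 + r^2)] and [u = 4 r / (1 + r^2)^2];
    [z = r^3 / 2] and [u = 2 r - r^4];
    [z = r^4 / (1 + r^4)] and [u = 2 r / (1 + r^4)];
    with [u = 1] reached at [r = s^3 / 2, s^2, s, s] respectively.  The integrand
    becomes a rational function of [r].  The denominator [1 - u] contains the
    minimal polynomial of the end point, and the factor [- 5 - g] cancels it;
    what remains has elementary primitives ([prim1] to [prim4]), with
    logarithms of [1 - r], [1 + r^2] and the like as the only transcendental
    part.

    At the end point the rational parts live in the cubic field of [s]; together
    with the terms in [k] and [1] they add up to a rational number.  The logarithms combine with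
    [- 4 ln (1 - z) = 4 ln (2 s)]: since [2] is totally ramified in that field,
    [(1 - s)^3 = 2 s^5], everything is a combination of [ln 2] and [ln s], and
    the coefficient of [ln s] vanishes. *)

(** * The generating function of the numbers [4k choose k] *)

Definition binom4 (k : nat) : R := Binomial.C (4 * k) k.

Lemma C_pos n k : 0 < Binomial.C n k.
Proof.
unfold Binomial.C, Rdiv. apply Rmult_lt_0_compat.
- apply INR_fact_lt_0.
- apply Rinv_0_lt_compat, Rmult_lt_0_compat; apply INR_fact_lt_0.
Qed.

Lemma C_absorption n k :
  INR (S k) * Binomial.C (S n) (S k) = INR (S n) * Binomial.C n k.
Proof.
unfold Binomial.C. rewrite !fact_simpl, !mult_INR. simpl (S n - S k)%nat.
field. repeat split; try apply INR_fact_neq_0; apply not_0_INR; lia.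
Qed.

(** A single term of the binomial expansion; used below as an exponential
    (Chernoff) bound on binomial probabilities. *)
Lemma binomial_term_le n k x y :
  (k <= n)%nat -> 0 <= x -> 0 <= y ->
  Binomial.C n k * x ^ k * y ^ (n - k) <= (x + y) ^ n.
Proof.
intros Hk Hx Hy. rewrite binomial.
set (f := fun i => Binomial.C n i * x ^ i * y ^ (n - i)).
assert (f_ge0 : forall i, 0 <= f i).
{ intros i. unfold f. apply Rmult_le_pos; [apply Rmult_le_pos|];
  try (apply pow_le; assumption). apply Rlt_le, C_pos. }
change (f k <= sum_f_R0 f n).
clearbody f. induction n as [|n IH].
- replace k with 0%nat by lia. simpl. lra.
- simpl. destruct (Nat.eq_dec k (S n)) as [->|Hne].
  + pose proof (cond_pos_sum f n f_ge0). lra.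
  + assert (f k <= sum_f_R0 f n) by (apply IH; lia). specialize (f_ge0 (S n)). lra.
Qed.

Definition lagr (z : R) : R := z * (1 - z) ^ 3.

(** Consider the random walk on the integers with steps [+ 3], of probability
    [z], and [- 1], of probability [1 - z].  Starting from [0], it is at [- a]
    after [k] steps up exactly at time [4 k + a]; [visit z a k] is the
    probability of this, and the sum over [k] is the expected number of visits
    to [- a]. *)
Definition visit (z : R) (a k : nat) : R :=
  Binomial.C (4 * k + a) k * z ^ k * (1 - z) ^ (3 * k + a).

Definition green (z : R) (a : nat) : R := Series (visit z a).

Lemma visit_ge0 z a k : 0 <= z <= 1 / 10 ->
  0 <= visit z a k.
Proof.
intros z_range. unfold visit. apply Rmult_le_pos; [apply Rmult_le_pos|];
  try (apply pow_le; lra). apply Rlt_le, C_pos.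
Qed.

(** Doubling the weight of the up steps turns the binomial bound into
    [(1 + z)^(4k+a) / 2^k], and [(1 + z)^4 / 2 < 3/4] on the range of [z]. *)
Lemma visit_le z a k : 0 <= z <= 1 / 10 ->
  visit z a k <= (11 / 10) ^ a * (3 / 4) ^ k.
Proof.
intros z_range. pose proof (binomial_term_le (4 * k + a) k (2 * z) (1 - z)
  ltac:(lia) ltac:(lra) ltac:(lra)) as H.
replace (4 * k + a - k)%nat with (3 * k + a)%nat in H by lia.
rewrite Rpow_mult_distr in H.
assert (Hv : visit z a k * 2 ^ k <= (1 + z) ^ (4 * k + a)).
{ unfold visit. replace (1 + z) with (2 * z + (1 - z)) by ring. lra. }
apply Rmult_le_reg_r with (2 ^ k); [apply pow_lt; lra|].
apply Rle_trans with (1 := Hv).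
rewrite Rmult_assoc, <- Rpow_mult_distr, Nat.add_comm, pow_add, pow_mult.
apply Rmult_le_compat; try (apply pow_le; try apply pow_le; lra).
- apply pow_incr. lra.
- apply pow_incr. split; [apply pow_le; lra|].
  apply Rle_trans with ((11 / 10) ^ 4); [apply pow_incr; lra|lra].
Qed.

Lemma is_series_geom_scaled a :
  is_series (fun k => (11 / 10) ^ a * (3 / 4) ^ k) (4 * (11 / 10) ^ a).
Proof.
replace (4 * (11 / 10) ^ a) with (scal ((11 / 10) ^ a) (/ (1 - 3 / 4)))
  by (unfold scal; simpl; unfold mult; simpl; field).
apply (is_series_scal (V := R_NormedModule) ((11 / 10) ^ a)).
apply is_series_geom. rewrite Rabs_pos_eq; lra.
Qed.

Lemma ex_series_visit z a : 0 <= z <= 1 / 10 ->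
  ex_series (visit z a).
Proof.
intros z_range. apply (ex_series_le (V := R_CompleteNormedModule))
  with (fun k => (11 / 10) ^ a * (3 / 4) ^ k).
- intros k. unfold norm; simpl; unfold abs; simpl.
  rewrite Rabs_pos_eq by apply visit_ge0, z_range. apply visit_le, z_range.
- eexists. apply is_series_geom_scaled.
Qed.

Lemma green_bound z a : 0 <= z <= 1 / 10 ->
  0 <= green z a <= 4 * (11 / 10) ^ a.
Proof.
intros z_range. unfold green. split.
- replace 0 with (Series (fun k => 0 * visit z a k)) by (rewrite Series_scal_l; ring).
  apply Series_le; [|apply ex_series_visit, z_range].
  intros k. pose proof (visit_ge0 z a k z_range). lra.
- rewrite <- (is_series_unique _ _ (is_series_geom_scaled a)).
  apply Series_le; [|eexists; apply is_series_geom_scaled].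
  intros k. split; [apply visit_ge0, z_range|apply visit_le, z_range].
Qed.

(** Pascal's rule, read as conditioning on the last step of the walk: the site
    [- (a + 1)] is entered from [- a] by a step down or from [- (a + 4)] by a
    step up. *)
Lemma green_pascal z a : 0 <= z <= 1 / 10 ->
  green z (S a) = (1 - z) * green z a + z * green z (a + 4).
Proof.
intros z_range. unfold green.
rewrite (Series_incr_1 (visit z (S a))) by apply ex_series_visit, z_range.
rewrite (Series_incr_1 (visit z a)) by apply ex_series_visit, z_range.
rewrite (Series_ext (fun k => visit z (S a) (S k))
  (fun k => (1 - z) * visit z a (S k) + z * visit z (a + 4) k)).
- rewrite Series_plus, !Series_scal_l.
  + unfold visit. simpl (4 * 0 + _)%nat. simpl (3 * 0 + _)%nat.
    unfold Binomial.C. rewrite !Nat.sub_0_r. simpl (fact 0). simpl.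
    pose proof (INR_fact_neq_0 a). pose proof (INR_fact_neq_0 (S a)).
    simpl in *. field. auto.
  + apply (ex_series_scal (1 - z) (fun k => visit z a (S k))).
    apply ex_series_incr_1 with (a := visit z a), ex_series_visit, z_range.
  + apply (ex_series_scal z (visit z (a + 4))), ex_series_visit, z_range.
- intros k. unfold visit.
  replace (4 * S k + S a)%nat with (S (4 * k + (a + 4))) by lia.
  replace (4 * S k + a)%nat with (4 * k + (a + 4))%nat by lia.
  replace (3 * S k + S a)%nat with (S (3 * k + a + 3)) by lia.
  replace (3 * S k + a)%nat with (3 * k + a + 3)%nat by lia.
  replace (3 * k + (a + 4))%nat with (S (3 * k + a + 3)) by lia.
  rewrite <- pascal by lia. simpl pow. ring.
Qed.

(** The walk goes down one unit at a time and drifts downwards, so it reaches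
    every site [- a], and all of them are visited equally often.
    Analytically: the differences [d] of consecutive values satisfy
    [(1 - z) d_b = z (d_(b+1) + d_(b+2) + d_(b+3))]; as they grow at most
    like [(11/10)^b], this recurrence halves any such bound, so they vanish. *)
Lemma green_step z a : 0 <= z <= 1 / 10 ->
  green z a = green z (S a).
Proof.
intros z_range. pose (d := fun b => green z b - green z (S b)).
assert (d_rec : forall b, (1 - z) * d b = z *
  (d (b + 1)%nat + d (b + 2)%nat + d (b + 3)%nat)).
{ intros b. unfold d. pose proof (green_pascal z b z_range) as H.
  replace (S (b + 1)) with (b + 2)%nat by lia.
  replace (S (b + 2)) with (b + 3)%nat by lia.
  replace (S (b + 3)) with (b + 4)%nat by lia.
  replace (b + 1)%nat with (S b) by lia. lra. }
assert (d_bound : forall n b, Rabs (d b) <= 10 * (/ 2) ^ n * (11 / 10) ^ b).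
{ induction n as [|n IH]; intros b.
  - unfold d. pose proof (green_bound z b z_range) as H.
    pose proof (green_bound z (S b) z_range) as H'.
    simpl in *. assert (0 < (11 / 10) ^ b) by (apply pow_lt; lra).
    apply Rabs_le. lra.
  - assert (H : Rabs ((1 - z) * d b) <=
      z * (Rabs (d (b + 1)%nat) + Rabs (d (b + 2)%nat) + Rabs (d (b + 3)%nat))).
    { rewrite d_rec, Rabs_mult, (Rabs_pos_eq z) by lra.
      apply Rmult_le_compat_l; [lra|].
      eapply Rle_trans; [apply Rabs_triang|]. apply Rplus_le_compat_r, Rabs_triang. }
    rewrite Rabs_mult, (Rabs_pos_eq (1 - z)) in H by lra.
    pose proof (IH (b + 1)%nat) as H1. pose proof (IH (b + 2)%nat) as H2.
    pose proof (IH (b + 3)%nat) as H3. rewrite !pow_add in *.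
    set (M := 10 * (/ 2) ^ n * (11 / 10) ^ b).
    assert (0 < M).
    { unfold M. repeat apply Rmult_lt_0_compat; try apply pow_lt; lra. }
    replace (10 * (/ 2) ^ S n * (11 / 10) ^ b) with (M / 2)
      by (unfold M; simpl; field).
    assert (H1' : Rabs (d (b + 1)%nat) <= 11 / 10 * M) by (unfold M; lra).
    assert (H2' : Rabs (d (b + 2)%nat) <= 121 / 100 * M) by (unfold M; lra).
    assert (H3' : Rabs (d (b + 3)%nat) <= 1331 / 1000 * M) by (unfold M; lra).
    assert (z * (Rabs (d (b + 1)%nat) + Rabs (d (b + 2)%nat) + Rabs (d (b + 3)%nat))
      <= 1 / 10 * (3641 / 1000 * M)).
    { apply Rmult_le_compat; try lra.
      repeat apply Rplus_le_le_0_compat; apply Rabs_pos. }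
    pose proof (Rabs_pos (d b)). nra. }
assert (Hd : Rabs (d a) <= 0).
{ apply (is_lim_seq_le (fun _ => Rabs (d a)) (fun n => 10 * (11 / 10) ^ a * (/ 2) ^ n)
    (Rabs (d a)) 0).
  - intros n. specialize (d_bound n a). lra.
  - apply is_lim_seq_const.
  - replace (Finite 0) with (Rbar_mult (10 * (11 / 10) ^ a) 0)
      by (simpl; f_equal; ring).
    apply is_lim_seq_scal_l, is_lim_seq_geom. rewrite Rabs_pos_eq; lra. }
assert (d a = 0) by (pose proof (Rabs_pos (d a)); apply Rabs_eq_0; lra).
unfold d in *. lra.
Qed.

(** The relation [c_(k+1) = 4 (4k+3 choose k)] reads
    [green z 0 = 1 + 4 z green z 3]; as [green z] is constant, this is a linear
    equation for its value. *)
Lemma is_series_binom4 z : 0 <= z <= 1 / 10 ->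
  is_series (fun k => binom4 k * lagr z ^ k) (/ (1 - 4 * z)).
Proof.
intros z_range. assert (Hgen : green z 0 = 1 + 4 * z * green z 3).
{ unfold green at 1. rewrite Series_incr_1 by apply ex_series_visit, z_range.
  rewrite (Series_ext _ (fun k => 4 * z * visit z 3 k)).
  - rewrite Series_scal_l. unfold visit at 1, green. simpl. unfold Binomial.C. simpl. field.
  - intros k. unfold visit.
    replace (4 * S k + 0)%nat with (S (4 * k + 3)) by lia.
    replace (3 * S k + 0)%nat with (3 * k + 3)%nat by lia.
    pose proof (C_absorption (4 * k + 3) k) as H.
    replace (INR (S (4 * k + 3))) with (4 * INR (S k)) in H
      by (rewrite !S_INR, plus_INR, mult_INR; simpl; ring).
    assert (INR (S k) <> 0) by (apply not_0_INR; lia).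
    assert (Binomial.C (S (4 * k + 3)) (S k) = 4 * Binomial.C (4 * k + 3) k) as ->.
    { apply Rmult_eq_reg_l with (INR (S k)); [rewrite H; ring|assumption]. }
    simpl pow. ring. }
assert (H03 : green z 0 = green z 3)
  by (rewrite (green_step z 0), (green_step z 1), (green_step z 2) by exact z_range;
    reflexivity).
replace (/ (1 - 4 * z)) with (green z 0).
- apply is_series_ext with (visit z 0); [|apply Series_correct, ex_series_visit, z_range].
  intros k. unfold visit, binom4, lagr. rewrite !Nat.add_0_r, Rpow_mult_distr, pow_mult.
  simpl; ring.
- apply Rmult_eq_reg_l with (1 - 4 * z); [|lra].
  rewrite Rinv_r by lra. rewrite <- H03 in Hgen. lra.
Qed.

(** * Series rules over the reals *)

(** This rule and the next two are generic facts about normed modules, restated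
    so that their side equations live in [R], where [ring] and [field] apply. *)
Lemma is_series_eq (a b : nat -> R) (l l' : R) :
  (forall k, a k = b k) -> l = l' -> is_series a l -> is_series b l'.
Proof. intros Hab <-. apply is_series_ext, Hab. Qed.

Lemma is_series_plusR (a b : nat -> R) (la lb : R) :
  is_series a la -> is_series b lb -> is_series (fun k => a k + b k) (la + lb).
Proof. apply (is_series_plus (V := R_NormedModule)). Qed.

Lemma is_series_scalR (c : R) (a : nat -> R) (l : R) :
  is_series a l -> is_series (fun k => c * a k) (c * l).
Proof. apply (is_series_scal (V := R_NormedModule) c). Qed.

Lemma is_series_shift (a : nat -> R) (l : R) :
  is_series (fun k => a (S k)) l <-> is_series a (a 0%nat + l).
Proof.
split; intros H.
- apply (is_series_decr_1 (V := R_NormedModule)).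
  replace (plus _ _) with l; [exact H|].
  unfold plus, opp; simpl. change (l = a 0%nat + l + - a 0%nat). ring.
- apply (is_series_incr_1 (V := R_NormedModule)).
  replace (plus _ _) with (a 0%nat + l); [exact H|].
  unfold plus; simpl. change (a 0%nat + l = l + a 0%nat). ring.
Qed.

(** * The Euler operator [x d/dx] *)

Lemma lagr_lt y z : 0 <= y -> y < z -> z <= 1 / 10 -> lagr y < lagr z.
Proof.
intros Hy Hyz Hz. unfold lagr.
assert (H : 0 < (z - y) * ((1 - 3 * (y + z) + 3 * (z * z + z * y + y * y))
   - (z + y) * (z * z + y * y))).
{ apply Rmult_lt_0_compat; [lra|].
  assert (0 <= z * z) by nra. assert (0 <= y * y) by nra.
  assert (0 <= z * y) by nra. nra. }
apply Rminus_lt_0. ring_simplify. ring_simplify in H. lra.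
Qed.

Lemma lagr_ge0 z : 0 <= z <= 1 / 10 -> 0 <= lagr z.
Proof. intros Hz. apply Rmult_le_pos; [lra|apply pow_le; lra]. Qed.

Lemma is_derive_lagr z : is_derive lagr z ((1 - z) ^ 2 * (1 - 4 * z)).
Proof. unfold lagr. auto_derive; [trivial|ring]. Qed.

Lemma CV_radius_gt (e : nat -> R) (x y : R) :
  0 <= x < y -> ex_series (fun k => e k * y ^ k) ->
  Rbar_lt (Rabs x) (CV_radius e).
Proof.
intros Hxy Hy. apply Rbar_lt_le_trans with (Finite (Rabs y)).
- simpl. rewrite !Rabs_pos_eq; lra.
- apply Rbar_not_lt_le. intros H. apply (CV_disk_outside _ _ H), ex_series_lim_0, Hy.
Qed.

(** [x d/dx] multiplies the [k]-th coefficient by [k]. *)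
Lemma PS_derive_scaled (e : nat -> R) (x : R) :
  Rbar_lt (Rabs x) (CV_radius e) ->
  is_series (fun k => INR k * e k * x ^ k) (x * PSeries (PS_derive e) x).
Proof.
intros Hx.
replace (x * _) with (INR 0 * e 0%nat * x ^ 0 + x * PSeries (PS_derive e) x)
  by (simpl; ring).
apply (is_series_shift (fun k => INR k * e k * x ^ k)).
apply (is_series_eq (fun k => x * (PS_derive e k * x ^ k)) _ (x * PSeries (PS_derive e) x));
  [intros k; unfold PS_derive; simpl pow; ring|reflexivity|].
apply is_series_scalR, Series_correct, ex_series_Rabs.
apply CV_disk_inside. rewrite CV_radius_derive. exact Hx.
Qed.

(** Transport of [x d/dx] along [x = z (1 - z)^3], where
    [dx/dz = (1 - z)^2 (1 - 4z)]. *)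
Lemma euler_operator (e : nat -> R) (f : R -> R) (z l : R) :
  (forall y, 0 < y < 1 / 10 -> is_series (fun k => e k * lagr y ^ k) (f y)) ->
  0 < z < 1 / 10 -> is_derive f z l ->
  is_series (fun k => INR k * e k * lagr z ^ k) (z * (1 - z) / (1 - 4 * z) * l).
Proof.
intros Hf Hz Hl.
assert (Hcv : Rbar_lt (Rabs (lagr z)) (CV_radius e)).
{ apply CV_radius_gt with (lagr ((z + 1 / 10) / 2)).
  - split; [apply lagr_ge0; lra|apply lagr_lt; lra].
  - eexists. apply Hf. lra. }
replace (z * (1 - z) / (1 - 4 * z) * l) with (lagr z * PSeries (PS_derive e) (lagr z));
  [apply PS_derive_scaled, Hcv|].
assert (Hcomp : is_derive (fun y => PSeries e (lagr y)) z
  ((1 - z) ^ 2 * (1 - 4 * z) * PSeries (PS_derive e) (lagr z))).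
{ apply (is_derive_comp (K := R_AbsRing) (V := R_NormedModule) (PSeries e) lagr).
  - apply is_derive_PSeries, Hcv.
  - apply is_derive_lagr. }
assert (Heq : is_derive (fun y => PSeries e (lagr y)) z l).
{ apply is_derive_ext_loc with f; [|exact Hl].
  apply (locally_interval _ z 0 (1 / 10)); simpl; try lra.
  intros y Hy0 Hy1. symmetry. apply is_series_unique, Hf. lra. }
apply is_derive_unique in Hcomp. apply is_derive_unique in Heq.
rewrite Hcomp in Heq. rewrite <- Heq. unfold lagr. field. lra.
Qed.

Lemma is_series_binom4_mul z : 0 < z < 1 / 10 ->
  is_series (fun k => INR k * binom4 k * lagr z ^ k) (4 * z * (1 - z) / (1 - 4 * z) ^ 3).
Proof.
intros Hz.
replace (4 * z * (1 - z) / (1 - 4 * z) ^ 3)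
  with (z * (1 - z) / (1 - 4 * z) * (4 / (1 - 4 * z) ^ 2)) by (field; lra).
apply (euler_operator _ (fun y => / (1 - 4 * y))); [|exact Hz|].
- intros y Hy. apply is_series_binom4. lra.
- auto_derive; [lra|field; lra].
Qed.

Lemma is_series_binom4_mul_sqr z : 0 < z < 1 / 10 ->
  is_series (fun k => INR k ^ 2 * binom4 k * lagr z ^ k)
    (4 * z * (1 - z) * (1 + 6 * z - 4 * z ^ 2) / (1 - 4 * z) ^ 5).
Proof.
intros Hz.
apply (is_series_eq (fun k => INR k * (INR k * binom4 k) * lagr z ^ k) _
  (z * (1 - z) / (1 - 4 * z) * (4 * (1 + 6 * z - 4 * z ^ 2) / (1 - 4 * z) ^ 4)));
  [intros k; ring|field; lra|].
apply (euler_operator _ (fun y => 4 * y * (1 - y) / (1 - 4 * y) ^ 3));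
  [exact is_series_binom4_mul|exact Hz|].
auto_derive; [apply (pow_nonzero (1 + - (4 * z)) 3); lra|field; lra].
Qed.

(** * Termwise integration *)

Lemma is_derive_continuity_pt (f : R -> R) (x l : R) :
  is_derive f x l -> continuity_pt f x.
Proof.
intros H. apply derivable_continuous_pt. exists l. apply is_derive_Reals, H.
Qed.

(** The derivative is prescribed, and the intermediate point is found, in the
    open interval only: the derivative formulas used below break down at the
    end points, where [1 - u] or [z] vanishes. *)
Lemma mean_value (f df : R -> R) (a b : R) :
  a < b ->
  (forall x, a < x < b -> is_derive f x (df x)) ->
  (forall x, a <= x <= b -> continuity_pt f x) ->
  exists c, a < c < b /\ f b - f a = df c * (b - a).
Proof.
intros Hab Hd Hc.
assert (pr1 : forall c, a < c < b -> derivable_pt f c).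
{ intros c Hac. exists (df c). apply is_derive_Reals, Hd, Hac. }
assert (pr2 : forall c, a < c < b -> derivable_pt id c)
  by (intros c _; apply derivable_pt_id).
destruct (MVT f id a b pr1 pr2 Hab Hc) as [c [Hac H]].
{ intros x _. apply derivable_continuous_pt, derivable_pt_id. }
exists c. split; [exact Hac|].
rewrite (derive_pt_eq_0 f c (df c)) in H by (apply is_derive_Reals, Hd, Hac).
rewrite (derive_pt_eq_0 id c 1) in H by apply derivable_pt_lim_id.
unfold id in H. lra.
Qed.

Lemma is_series_tail_le (a m : nat -> R) (l ml : R) (n : nat) :
  (forall k, Rabs (a k) <= m k) -> is_series a l -> is_series m ml ->
  Rabs (l - sum_n a n) <= ml - sum_n m n.
Proof.
intros Ham Ha Hm.
apply (is_lim_seq_le (fun p => Rabs (sum_n a (n + p) - sum_n a n))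
  (fun p => sum_n m (n + p) - sum_n m n) (Rabs (l - sum_n a n)) (ml - sum_n m n)).
- intros p. induction p as [|p IH].
  + rewrite Nat.add_0_r, !Rminus_diag, Rabs_R0. lra.
  + rewrite Nat.add_succ_r, !sum_Sn. unfold plus; simpl.
    replace (sum_n a (n + p) + a (S (n + p)) - sum_n a n)
      with (sum_n a (n + p) - sum_n a n + a (S (n + p))) by ring.
    pose proof (Rabs_triang (sum_n a (n + p) - sum_n a n) (a (S (n + p)))).
    specialize (Ham (S (n + p))). lra.
- apply (is_lim_seq_abs _ (l - sum_n a n)).
  apply (is_lim_seq_minus' _ _ l); [|apply is_lim_seq_const].
  apply (is_lim_seq_ext (fun p => sum_n a (p + n))); [intros p; f_equal; lia|].
  apply (is_lim_seq_incr_n (sum_n a)), Ha.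
- apply (is_lim_seq_minus' _ _ ml); [|apply is_lim_seq_const].
  apply (is_lim_seq_ext (fun p => sum_n m (p + n))); [intros p; f_equal; lia|].
  apply (is_lim_seq_incr_n (sum_n m)), Hm.
Qed.

(** The difference between [T] and a partial sum of the [f k] has a derivative
    bounded by the tail of [m], uniformly in [r]; by the mean value theorem so
    is the difference itself, up to the factor [r0]. *)
Lemma is_series_antiderivative (f df : nat -> R -> R) (m : nat -> R)
    (T dT : R -> R) (r0 : R) :
  0 < r0 ->
  (forall k r, 0 < r < r0 -> is_derive (f k) r (df k r)) ->
  (forall k r, 0 <= r <= r0 -> continuity_pt (f k) r) ->
  (forall k, f k 0 = 0) ->
  (forall k r, 0 < r < r0 -> Rabs (df k r) <= m k) ->
  ex_series m ->
  (forall r, 0 < r < r0 -> is_derive T r (dT r)) ->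
  (forall r, 0 <= r <= r0 -> continuity_pt T r) ->
  T 0 = 0 ->
  (forall r, 0 < r < r0 -> is_series (fun k => df k r) (dT r)) ->
  is_series (fun k => f k r0) (T r0).
Proof.
intros Hr0 Hdf Hcf Hf0 Hm [ml Hml] HdT HcT HT0 Hs.
assert (Hb : forall n, Rabs (sum_n (fun k => f k r0) n - T r0)
  <= r0 * (ml - sum_n m n)).
{ intros n.
  destruct (mean_value (fun r => T r - sum_n (fun k => f k r) n)
    (fun r => dT r - sum_n (fun k => df k r) n) 0 r0 Hr0) as [c [Hc H]].
  - intros r Hr. apply (is_derive_minus (V := R_NormedModule)); [apply HdT, Hr|].
    apply (is_derive_sum_n (V := R_NormedModule)). intros k _. apply Hdf, Hr.
  - intros r Hr. apply continuity_pt_minus; [apply HcT, Hr|].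
    clear -Hcf Hr. induction n as [|n IH].
    + apply (continuity_pt_ext (f 0%nat)); [|apply Hcf, Hr].
      intros t. rewrite sum_O. reflexivity.
    + apply (continuity_pt_ext (fun t => sum_n (fun k => f k t) n + f (S n) t)).
      * intros t. rewrite sum_Sn. reflexivity.
      * apply continuity_pt_plus; [apply IH|apply Hcf, Hr].
  - assert (Hz : sum_n (fun k => f k 0) n = 0).
    { clear -Hf0. induction n as [|n IH].
      - rewrite sum_O. apply Hf0.
      - rewrite sum_Sn, IH, Hf0. unfold plus; simpl. ring. }
    pose proof (is_series_tail_le (fun k => df k c) m (dT c) ml n
      (fun k => Hm k c Hc) (Hs c Hc) Hml) as Hle.
    cbv beta in H. rewrite Hz, HT0 in H.
    rewrite Rabs_minus_sym.
    replace (T r0 - sum_n (fun k => f k r0) n)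
      with ((dT c - sum_n (fun k => df k c) n) * r0) by lra.
    rewrite Rabs_mult, (Rabs_pos_eq r0) by lra. nra. }
assert (Hlim : is_lim_seq (sum_n (fun k => f k r0)) (0 + T r0));
  [|rewrite Rplus_0_l in Hlim; exact Hlim].
apply is_lim_seq_ext with (fun n => (sum_n (fun k => f k r0) n - T r0) + T r0);
  [intros n; ring|].
apply is_lim_seq_plus'; [|apply is_lim_seq_const].
apply is_lim_seq_abs_0.
apply is_lim_seq_le_le with (fun _ => 0) (fun n => r0 * (ml - sum_n m n)).
- intros n. split; [apply Rabs_pos|apply Hb].
- apply is_lim_seq_const.
- replace (Finite 0) with (Rbar_mult r0 (Finite (ml - ml))) by (simpl; f_equal; ring).
  apply is_lim_seq_scal_l, is_lim_seq_minus'; [apply is_lim_seq_const|exact Hml].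
Qed.

(** The derivative of [c_k x^k / k] in [z] is [(1 - 4z) / (z (1 - z))] times
    [c_k x^k], so the derivative of the sum is
    [(1 - 4z) / (z (1 - z)) (1 / (1 - 4z) - 1) = 4 / (1 - z)]. *)
Lemma is_series_binom4_div z : 0 < z < 1 / 10 ->
  is_series (fun k => binom4 (S k) / INR (S k) * lagr z ^ S k) (- 4 * ln (1 - z)).
Proof.
intros Hz.
apply (is_series_antiderivative
  (fun k y => binom4 (S k) / INR (S k) * lagr y ^ S k)
  (fun k y => binom4 (S k) * lagr y ^ k * ((1 - y) ^ 2 * (1 - 4 * y)))
  (fun k => binom4 (S k) * lagr z ^ k)
  (fun y => - 4 * ln (1 - y)) (fun y => 4 / (1 - y))).
- lra.
- assert (Hd : forall k y, is_derive (fun y => binom4 (S k) / INR (S k) * lagr y ^ S k) y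
    (binom4 (S k) / INR (S k) *
     (INR (S k) * ((1 - y) ^ 2 * (1 - 4 * y)) * lagr y ^ k))).
  { intros k y. apply is_derive_scal, (is_derive_pow lagr (S k)), is_derive_lagr. }
  intros k y _.
  replace (binom4 (S k) * lagr y ^ k * ((1 - y) ^ 2 * (1 - 4 * y)))
    with (binom4 (S k) / INR (S k) *
     (INR (S k) * ((1 - y) ^ 2 * (1 - 4 * y)) * lagr y ^ k)); [apply Hd|].
  field. apply not_0_INR. lia.
- intros k y _. eapply is_derive_continuity_pt.
  apply is_derive_scal, (is_derive_pow lagr (S k)), is_derive_lagr.
- intros k. unfold lagr. simpl. ring.
- intros k y Hy.
  assert (H0 : 0 <= lagr y) by (apply lagr_ge0; lra).
  assert (0 <= lagr y ^ k) by (apply pow_le, H0).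
  assert (lagr y ^ k <= lagr z ^ k)
    by (apply pow_incr; split; [exact H0|apply Rlt_le, lagr_lt; lra]).
  assert (0 < binom4 (S k)) by apply C_pos.
  rewrite Rabs_pos_eq.
  + rewrite <- (Rmult_1_r (binom4 (S k) * lagr z ^ k)).
    apply Rmult_le_compat; [apply Rmult_le_pos; lra| |apply Rmult_le_compat_l; lra|].
    * apply Rmult_le_pos; [apply pow_le|]; lra.
    * simpl. nra.
  + apply Rmult_le_pos; [apply Rmult_le_pos; lra|].
    apply Rmult_le_pos; [apply pow_le|]; lra.
- apply ex_series_ext with (fun k => / lagr z * (binom4 (S k) * lagr z ^ S k)).
  + intros k. change (/ lagr z * (binom4 (S k) * lagr z ^ S k) = binom4 (S k) * lagr z ^ k).
    simpl pow. field.
    apply Rgt_not_eq. apply Rle_lt_trans with (lagr 0); [apply lagr_ge0; lra|apply lagr_lt; lra].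
  + apply (ex_series_scal (V := R_NormedModule) (/ lagr z)).
    apply (ex_series_incr_1 (fun k => binom4 k * lagr z ^ k)).
    eexists. apply is_series_binom4. lra.
- intros y Hy. auto_derive; [lra|field; lra].
- intros y Hy. apply (is_derive_continuity_pt _ _ (4 / (1 - y))).
  auto_derive; [lra|field; lra].
- rewrite Rminus_0_r, ln_1. ring.
- intros y Hy.
  assert (Hx : 0 < lagr y).
  { apply Rle_lt_trans with (lagr 0); [apply lagr_ge0; lra|apply lagr_lt; lra]. }
  apply (is_series_eq
    (fun k => (1 - 4 * y) / (y * (1 - y)) * (binom4 (S k) * lagr y ^ S k)) _
    ((1 - 4 * y) / (y * (1 - y)) * (/ (1 - 4 * y) - 1))).
  + intros k. simpl pow. unfold lagr at 1. field. lra.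
  + field. lra.
  + apply is_series_scalR, (is_series_shift (fun k => binom4 k * lagr y ^ k)).
    replace (_ + _) with (/ (1 - 4 * y)); [apply is_series_binom4; lra|].
    unfold binom4, Binomial.C. simpl. field. lra.
Qed.

(** * The weighted harmonic sums as integrals *)

Definition coef (k : nat) : R := weight k * P (INR k).

(** The function [g] with [g(z) = sum P(k) c_k x^k]: the combination
    [22, - 92, 11] of the sums with weights [k^2, k, 1]. *)
Definition coef_gf (z : R) : R :=
  (11 * (1 - 4 * z) ^ 4 - 368 * z * (1 - z) * (1 - 4 * z) ^ 2
   + 88 * z * (1 - z) * (1 + 6 * z - 4 * z ^ 2)) / (1 - 4 * z) ^ 5.

Lemma weight_scaled k x : weight k * (16 * x) ^ k = binom4 k * x ^ k.
Proof.
unfold weight, binom4. rewrite Rpow_mult_distr. field. apply pow_nonzero. lra.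
Qed.

Lemma is_series_coef z : 0 < z < 1 / 10 ->
  is_series (fun k => coef k * (16 * lagr z) ^ k) (coef_gf z).
Proof.
intros Hz.
apply (is_series_eq
  (fun k => 22 * (INR k ^ 2 * binom4 k * lagr z ^ k)
    + - 92 * (INR k * binom4 k * lagr z ^ k) + 11 * (binom4 k * lagr z ^ k)) _
  (22 * (4 * z * (1 - z) * (1 + 6 * z - 4 * z ^ 2) / (1 - 4 * z) ^ 5)
    + - 92 * (4 * z * (1 - z) / (1 - 4 * z) ^ 3) + 11 * / (1 - 4 * z))).
- intros k. unfold coef.
  replace (weight k * P (INR k) * (16 * lagr z) ^ k)
    with (P (INR k) * (weight k * (16 * lagr z) ^ k)) by ring.
  rewrite weight_scaled. unfold P. ring.
- unfold coef_gf. field. lra.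
- repeat apply is_series_plusR; apply is_series_scalR.
  + apply is_series_binom4_mul_sqr, Hz.
  + apply is_series_binom4_mul, Hz.
  + apply is_series_binom4. lra.
Qed.

(** The truncated series of [- ln (1 - u)], that is, the integral of
    [(1 - v^n) / (1 - v)] from [0] to [u]; it interpolates between [0] at
    [u = 0] and [H_n] at [u = 1]. *)
Fixpoint log_poly (n : nat) (u : R) : R :=
  match n with O => 0 | S p => log_poly p u + u ^ S p / INR (S p) end.

Lemma log_poly_1 n : log_poly n 1 = harmonic n.
Proof.
induction n as [|n IH].
- unfold harmonic. rewrite sum_n_m_zero by lia. reflexivity.
- cbn [log_poly]. unfold harmonic in *. rewrite sum_n_Sm by lia. rewrite IH, pow1.
  unfold plus, Rdiv; cbn -[INR]. ring.
Qed.

Lemma log_poly_0 n : log_poly n 0 = 0.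
Proof.
induction n as [|n IH]; [reflexivity|]. cbn [log_poly]. rewrite IH. simpl pow.
unfold Rdiv. ring.
Qed.

(** The derivative is characterized by a product, which also makes sense at
    [u = 1]. *)
Lemma is_derive_log_poly n u : exists d, is_derive (log_poly n) u d /\ (1 - u) * d = 1 - u ^ n.
Proof.
induction n as [|n [d [Hd Hmul]]].
- exists 0. split; [|simpl; ring].
  apply (is_derive_const (V := R_NormedModule)).
- exists (d + u ^ n). split; [|simpl; lra].
  apply (is_derive_plus (V := R_NormedModule) (log_poly n) (fun u => u ^ S n / INR (S n)));
    [exact Hd|].
  replace (u ^ n) with (/ INR (S n) * (INR (S n) * 1 * u ^ n))
    by (field; apply not_0_INR; lia).
  apply (is_derive_ext (fun u => / INR (S n) * u ^ S n)).
  { intros t. unfold Rdiv. apply Rmult_comm. }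
  apply is_derive_scal, (is_derive_pow (fun u => u) (S n)).
  apply (is_derive_id (K := R_AbsRing)).
Qed.

Lemma geom_quotient_bound n u : 0 <= u < 1 -> 0 <= (1 - u ^ n) / (1 - u) <= INR n.
Proof.
intros Hu. induction n as [|n IH].
- simpl. unfold Rdiv. lra.
- replace ((1 - u ^ S n) / (1 - u)) with ((1 - u ^ n) / (1 - u) + u ^ n)
    by (simpl; field; lra).
  assert (0 <= u ^ n) by (apply pow_le; lra).
  assert (u ^ n <= 1) by (rewrite <- (pow1 n); apply pow_incr; lra).
  rewrite S_INR. lra.
Qed.

Lemma weight_ge0 k : 0 <= weight k.
Proof.
unfold weight. apply Rmult_le_pos; [apply Rlt_le, C_pos|].
apply Rlt_le, Rinv_0_lt_compat, pow_lt. lra.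
Qed.

Lemma weight_binom4 z k : 16 * lagr z = 1 -> weight k = binom4 k * lagr z ^ k.
Proof. intros Hz. rewrite <- weight_scaled, Hz, pow1. ring. Qed.

(** The point [1/16] lies inside the disk of convergence, so that the Euler
    operator can be applied once more, giving the weight [k^3]; [k |P(k)|] is
    dominated by a combination of [k^3, k^2, k]. *)
Lemma ex_series_coef_INR z : 0 < z < 1 / 10 -> 16 * lagr z = 1 ->
  ex_series (fun k => Rabs (coef k) * INR k).
Proof.
intros Hz H16.
assert (Hk : forall p f, (forall y, 0 < y < 1 / 10 ->
    is_series (fun k => INR k ^ p * binom4 k * lagr y ^ k) (f y)) ->
  ex_series (fun k => INR k ^ S p * weight k)).
{ intros p f Hf.
  exists (lagr z * PSeries (PS_derive (fun k => INR k ^ p * binom4 k)) (lagr z)).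
  apply (is_series_eq (fun k => INR k * (INR k ^ p * binom4 k) * lagr z ^ k) _
    (lagr z * PSeries (PS_derive (fun k => INR k ^ p * binom4 k)) (lagr z)));
    [intros k; rewrite (weight_binom4 z k H16); simpl pow; ring|reflexivity|].
  apply PS_derive_scaled, CV_radius_gt with (lagr ((z + 1 / 10) / 2)).
  - split; [apply lagr_ge0; lra|apply lagr_lt; lra].
  - eexists. apply Hf. lra. }
assert (H3 := Hk 2%nat _ is_series_binom4_mul_sqr).
assert (H2 : ex_series (fun k => INR k ^ 2 * weight k)).
{ apply (Hk 1%nat (fun y => 4 * y * (1 - y) / (1 - 4 * y) ^ 3)). intros y Hy.
  apply (is_series_eq (fun k => INR k * binom4 k * lagr y ^ k) _
    (4 * y * (1 - y) / (1 - 4 * y) ^ 3)); [intros k; ring|reflexivity|].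
  apply is_series_binom4_mul, Hy. }
assert (H1 : ex_series (fun k => INR k ^ 1 * weight k)).
{ apply (Hk 0%nat (fun y => / (1 - 4 * y))). intros y Hy.
  apply (is_series_eq (fun k => binom4 k * lagr y ^ k) _ (/ (1 - 4 * y)));
    [intros k; ring|reflexivity|].
  apply is_series_binom4. lra. }
destruct H1 as [l1 H1], H2 as [l2 H2], H3 as [l3 H3].
apply (ex_series_le (V := R_CompleteNormedModule)) with
  (fun k => 22 * (INR k ^ 3 * weight k) + 92 * (INR k ^ 2 * weight k)
    + 11 * (INR k ^ 1 * weight k)).
- intros k. unfold norm; simpl norm; unfold abs; simpl abs.
  rewrite Rabs_pos_eq by (apply Rmult_le_pos; [apply Rabs_pos|apply pos_INR]).
  unfold coef. rewrite Rabs_mult, (Rabs_pos_eq (weight k)) by apply weight_ge0.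
  assert (HP : Rabs (P (INR k)) <= 22 * INR k ^ 2 + 92 * INR k + 11).
  { pose proof (pos_INR k). pose proof (pow2_ge_0 (INR k)).
    unfold P. apply Rabs_le. lra. }
  pose proof (weight_ge0 k). pose proof (pos_INR k).
  assert (0 <= weight k * INR k) by (apply Rmult_le_pos; lra).
  replace (weight k * Rabs (P (INR k)) * INR k)
    with (weight k * INR k * Rabs (P (INR k))) by ring.
  eapply Rle_trans; [apply Rmult_le_compat_l; [assumption|exact HP]|].
  apply Req_le. ring.
- eexists. repeat apply is_series_plusR; apply is_series_scalR; eassumption.
Qed.

(** The integral representation of the harmonic sums, along a parametrization
    [r -> (Z r, U r)] of the curve [u^m = 16 z (1 - z)^3] that starts at
    [u = 0] and reaches [u = 1] at [r0].  Termwise, the [k]-th integrand is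
    [P(k) c_k 16^-k (1 - u^(mk)) / (1 - u) du]; these sum to
    [(g(z0) - g(z)) / (1 - u) du] with [g(z0) = - 5].  The integrands are
    uniformly summable because [(1 - u^n) / (1 - u)] is at most [n]. *)
Lemma is_series_coef_harmonic (m : nat) (Z U T dU : R -> R) (r0 z0 M : R) :
  0 < r0 -> 0 < z0 < 1 / 10 -> 16 * lagr z0 = 1 -> coef_gf z0 = - 5 ->
  (forall r, 0 < r < r0 -> 0 < Z r < 1 / 10) ->
  (forall r, 0 < r < r0 -> U r ^ m = 16 * lagr (Z r)) ->
  (forall r, 0 <= r <= r0 -> is_derive U r (dU r)) ->
  (forall r, 0 < r < r0 -> 0 < dU r <= M) ->
  U 0 = 0 -> U r0 = 1 ->
  (forall r, 0 <= r <= r0 -> ex_derive T r) ->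
  (forall r, 0 < r < r0 -> U r < 1 ->
     is_derive T r ((- 5 - coef_gf (Z r)) * dU r / (1 - U r))) ->
  T 0 = 0 ->
  is_series (fun k => coef k * harmonic (m * k)) (T r0).
Proof.
intros Hr0 Hz0 H16 Hgen0 HZ HUZ HU HdU HU0 HU1 HexT HT HT0.
assert (HcU : forall r, 0 <= r <= r0 -> continuity_pt U r)
  by (intros r Hr; apply (is_derive_continuity_pt _ _ _ (HU r Hr))).
assert (Hrange : forall r, 0 < r < r0 -> 0 <= U r < 1).
{ intros r Hr.
  destruct (mean_value U dU 0 r) as [c [Hc Hl]]; try lra;
    [intros; apply HU; lra|intros; apply HcU; lra|].
  destruct (mean_value U dU r r0) as [c' [Hc' Hl']]; try lra;
    [intros; apply HU; lra|intros; apply HcU; lra|].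
  pose proof (HdU c ltac:(lra)). pose proof (HdU c' ltac:(lra)).
  assert (0 < dU c * (r - 0)) by (apply Rmult_lt_0_compat; lra).
  assert (0 < dU c' * (r0 - r)) by (apply Rmult_lt_0_compat; lra). lra. }
assert (Hh : forall n r, 0 <= r <= r0 -> exists d,
  is_derive (fun r => log_poly n (U r)) r (dU r * d) /\ (1 - U r) * d = 1 - U r ^ n).
{ intros n r Hr. destruct (is_derive_log_poly n (U r)) as [d [Hd Hmul]].
  exists d. split; [|exact Hmul].
  apply (is_derive_comp (K := R_AbsRing) (V := R_NormedModule) (log_poly n) U);
    [exact Hd|apply HU, Hr]. }
apply is_series_ext with (fun k => coef k * log_poly (m * k) (U r0)).
{ intros k. rewrite HU1, log_poly_1. reflexivity. }
apply (is_series_antiderivative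
  (fun k r => coef k * log_poly (m * k) (U r))
  (fun k r => coef k * (dU r * ((1 - U r ^ (m * k)) / (1 - U r))))
  (fun k => M * INR m * (Rabs (coef k) * INR k))
  T (fun r => (- 5 - coef_gf (Z r)) * dU r / (1 - U r)) r0); try assumption.
- intros k r Hr. specialize (Hrange r Hr).
  destruct (Hh (m * k)%nat r ltac:(lra)) as [d [Hd Hmul]].
  apply is_derive_scal.
  replace ((1 - U r ^ (m * k)) / (1 - U r)) with d; [exact Hd|].
  rewrite <- Hmul. field. lra.
- intros k r Hr. destruct (Hh (m * k)%nat r Hr) as [d [Hd _]].
  eapply is_derive_continuity_pt, is_derive_scal, Hd.
- intros k. rewrite HU0, log_poly_0. ring.
- intros k r Hr. specialize (Hrange r Hr). specialize (HdU r Hr).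
  pose proof (geom_quotient_bound (m * k) (U r) Hrange) as Hq.
  rewrite mult_INR in Hq.
  rewrite !Rabs_mult, (Rabs_pos_eq (dU r)), (Rabs_pos_eq (_ / _)) by lra.
  replace (M * INR m * (Rabs (coef k) * INR k))
    with (Rabs (coef k) * (M * (INR m * INR k))) by ring.
  apply Rmult_le_compat_l; [apply Rabs_pos|]. apply Rmult_le_compat; lra.
- destruct (ex_series_coef_INR z0 Hz0 H16) as [l Hl].
  eexists. apply is_series_scalR, Hl.
- intros r Hr. apply HT; [exact Hr|apply Hrange, Hr].
- intros r Hr. destruct (HexT r Hr) as [d Hd]. apply (is_derive_continuity_pt _ _ _ Hd).
- intros r Hr. specialize (Hrange r Hr).
  apply (is_series_eq
    (fun k => dU r / (1 - U r) *
       (coef k * (16 * lagr z0) ^ k + - 1 * (coef k * (16 * lagr (Z r)) ^ k))) _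
    (dU r / (1 - U r) * (coef_gf z0 + - 1 * coef_gf (Z r)))).
  + intros k. rewrite H16, pow1, <- HUZ, <- pow_mult by exact Hr. field. lra.
  + rewrite Hgen0. field. lra.
  + apply is_series_scalR, is_series_plusR; [|apply is_series_scalR];
      apply is_series_coef; [exact Hz0|apply HZ, Hr].
Qed.

(** * The reciprocal of the tribonacci constant *)

(** The defining equation is oriented as a rewrite rule for the normal forms
    modulo the cubic. *)
Definition trib (s : R) : Prop := 54 / 100 < s < 545 / 1000 /\ s ^ 3 = 1 - s - s ^ 2.

Lemma trib_exists : exists s, trib s.
Proof.
destruct (IVT (fun s => s ^ 3 + s ^ 2 + s - 1) (54 / 100) (545 / 1000)) as [s [Hs H]].
- intros x. eapply is_derive_continuity_pt.
  auto_derive; [trivial|reflexivity].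
- lra.
- lra.
- lra.
- exists s. split; [|lra].
  split; (destruct Hs as [[H1|H1] [H2|H2]]; subst; lra).
Qed.

Lemma trib_pow4 s : trib s -> s ^ 4 = 2 * s - 1.
Proof. intros [_ H]. replace (s ^ 4) with (s * s ^ 3) by ring. rewrite H. ring [H]. Qed.

Lemma trib_half_cube s : trib s -> 0 < s ^ 3 / 2 < 1 / 10.
Proof.
intros [Hs H]. rewrite H. nra.
Qed.

(** [16 z (1 - z)^3 = (s (2 - s^3))^3] is a cube at [z = s^3 / 2], and
    [s (2 - s^3) = 2 s - s^4 = 1]. *)
Lemma lagr_trib s : trib s -> 16 * lagr (s ^ 3 / 2) = 1.
Proof.
intros Hs. replace (16 * lagr (s ^ 3 / 2)) with ((2 * s - s ^ 4) ^ 3)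
  by (unfold lagr; field).
rewrite (trib_pow4 s Hs). ring.
Qed.

(** [1 - 14 z + 20 z^2 - 8 z^3] is the minimal polynomial of [s^3 / 2] up to a
    factor, the cofactor of [1 - 2 z] in [1 - 16 z (1 - z)^3].  It divides
    [g + 5]; this is the property that singles out the polynomial [P]. *)
Lemma coef_gf_trib s : trib s -> coef_gf (s ^ 3 / 2) = - 5.
Proof.
intros Hs. pose proof (trib_half_cube s Hs) as Hz. destruct Hs as [_ H].
set (z := s ^ 3 / 2) in *.
assert (Hcub : 1 - 14 * z + 20 * z ^ 2 - 8 * z ^ 3 = 0).
{ replace (1 - 14 * z + 20 * z ^ 2 - 8 * z ^ 3)
    with (1 - 7 * s ^ 3 + 5 * (s ^ 3) ^ 2 - (s ^ 3) ^ 3) by (unfold z; field).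
  rewrite H. ring [H]. }
apply Rminus_diag_uniq.
replace (coef_gf z - - 5) with
  ((1 - 14 * z + 20 * z ^ 2 - 8 * z ^ 3) * (16 - 332 * z + 640 * z ^ 2)
   / (1 - 4 * z) ^ 5) by (unfold coef_gf; field; lra).
rewrite Hcub. unfold Rdiv. ring.
Qed.

(** * The four integrals *)

(** Primitives, vanishing at [0], of [(- 5 - g(z)) / (1 - u) du] along the four
    parametrizations.  The poles of the integrand lie over [z = 1/4], coming from
    [g], over [z = 1/2], where [u^m = 1], and over the infinite value of [z].
    The coefficients were found by equating the derivative of a rational
    function with these poles plus logarithms to the integrand, which is a linear system for
    them. *)
Definition prim1 (z : R) : R :=
  (- 216 * z + 3240 * z ^ 2 - 6912 * z ^ 3) / (1 - 4 * z) ^ 3 + 20 * ln (1 - 2 * z).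

Definition prim2 (r : R) : R :=
  (- 44 * r - 108 * r ^ 2 + 460 * r ^ 3 + 1296 * r ^ 4 - 36 * r ^ 5 - 540 * r ^ 6
   - 540 * r ^ 7 - 1944 * r ^ 8) / ((1 - 3 * r ^ 2) ^ 3 * (1 + r ^ 2))
  + 20 * ln (1 - r) - 10 * ln (1 + r ^ 2).

Definition prim3 (r : R) : R :=
  (- 12 * r - 22 * r ^ 2 - 36 * r ^ 3 + 88 * r ^ 4 + 160 * r ^ 5 + 270 * r ^ 6
   - 80 * r ^ 7 - 160 * r ^ 8 - 288 * r ^ 9) / (1 - 2 * r ^ 3) ^ 3
  + 20 * ln (1 - r).

Definition prim4 (r : R) : R :=
  (- 12 * r - 22 * r ^ 2 - 36 * r ^ 3 - 54 * r ^ 4 + 124 * r ^ 5 + 230 * r ^ 6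
   + 396 * r ^ 7 + 648 * r ^ 8 + 28 * r ^ 9 - 18 * r ^ 10 - 108 * r ^ 11
   - 270 * r ^ 12 - 108 * r ^ 13 - 270 * r ^ 14 - 540 * r ^ 15 - 972 * r ^ 16)
   / ((1 - 3 * r ^ 4) ^ 3 * (1 + r ^ 4))
  + 20 * ln (1 - r) - 5 * ln (1 + r ^ 4).

(** The rational parts of [prim2] and [prim4] have this denominator, at
    [a = r^2] and [a = r^4]. *)
Lemma pole_nonzero a : 0 <= a < 1 / 3 -> (1 - 3 * a) ^ 3 * (1 + a) <> 0.
Proof.
intros Ha. apply Rmult_integral_contrapositive_currified;
  [apply pow_nonzero|]; lra.
Qed.

Lemma is_series_coef_H1 s : trib s ->
  is_series (fun k => coef k * harmonic (1 * k)) (prim1 (s ^ 3 / 2)).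
Proof.
intros Hs. pose proof (trib_half_cube s Hs) as Hz.
apply is_series_coef_harmonic with (Z := fun z => z) (U := fun z => 16 * lagr z)
  (dU := fun z => 16 * ((1 - z) ^ 2 * (1 - 4 * z))) (z0 := s ^ 3 / 2) (M := 16);
  try (intros r Hr).
- lra.
- lra.
- apply lagr_trib, Hs.
- apply coef_gf_trib, Hs.
- lra.
- ring.
- apply is_derive_scal, is_derive_lagr.
- assert (0 < (1 - r) ^ 2 <= 1) by (simpl; nra). nra.
- unfold lagr. ring.
- apply lagr_trib, Hs.
- eexists. unfold prim1. auto_derive; [|reflexivity].
  split; [apply (pow_nonzero (1 + - (4 * r)) 3)|split; [|trivial]]; lra.
- intros HU. unfold lagr in HU. unfold prim1, coef_gf, lagr. auto_derive.
  + split; [apply (pow_nonzero (1 + - (4 * r)) 3)|split; [|trivial]]; lra.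
  + field. repeat split; lra.
- unfold prim1. replace (1 - 2 * 0) with 1 by ring. rewrite ln_1. field.
Qed.

Lemma is_series_coef_H2 s : trib s ->
  is_series (fun k => coef k * harmonic (2 * k)) (prim2 (s ^ 2)).
Proof.
intros Hs. pose proof (trib_half_cube s Hs) as Hz.
pose proof (trib_pow4 s Hs) as H4.
pose proof (proj1 Hs) as Hs1.
assert (Hr2 : forall r, 0 <= r <= s ^ 2 -> 0 <= r ^ 2 < 1 / 11).
{ intros r Hr. pose proof (pow_le r 2 ltac:(lra)).
  pose proof (pow_incr r (s ^ 2) 2 Hr). rewrite <- pow_mult in *. simpl Nat.mul in *. lra. }
assert (Hs2 : 0 < s ^ 2 < 3 / 10) by nra.
apply is_series_coef_harmonic with (Z := fun r => r ^ 2 / (1 + r ^ 2))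
  (U := fun r => 4 * r / (1 + r ^ 2) ^ 2)
  (dU := fun r => 4 * (1 - 3 * r ^ 2) / (1 + r ^ 2) ^ 3) (z0 := s ^ 3 / 2) (M := 4);
  try (intros r Hr; pose proof (Hr2 r ltac:(lra))).
- lra.
- lra.
- apply lagr_trib, Hs.
- apply coef_gf_trib, Hs.
- pose proof (pow_lt r 2 ltac:(lra)).
  split; [apply Rdiv_lt_0_compat; lra|apply Rlt_div_l; lra].
- unfold lagr. field. lra.
- auto_derive; [|field; lra].
  apply (pow_nonzero (1 + r ^ 2) 2). lra.
- assert (1 <= (1 + r ^ 2) ^ 3) by (rewrite <- (pow1 3); apply pow_incr; lra).
  split; [apply Rdiv_lt_0_compat; nra|apply Rle_div_l; nra].
- field.
- rewrite <- pow_mult. simpl Nat.mul. rewrite H4. field. lra.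
- eexists. unfold prim2. auto_derive; [|reflexivity].
  split; [apply (pole_nonzero (r ^ 2))|repeat split]; simpl in *; lra.
- intros HU. unfold prim2, coef_gf.
  assert (HU' : 4 * r < (1 + r ^ 2) ^ 2) by (apply Rlt_div_l in HU; nra).
  auto_derive.
  + split; [apply (pole_nonzero (r ^ 2))|repeat split]; simpl in *; lra.
  + field. repeat split; lra.
- unfold prim2. rewrite Rminus_0_r, (pow_i 2), Rplus_0_r, ln_1 by lia. field.
Qed.

Lemma is_series_coef_H3 s : trib s ->
  is_series (fun k => coef k * harmonic (3 * k)) (prim3 s).
Proof.
intros Hs. pose proof (trib_half_cube s Hs) as Hz.
assert (Hr3 : forall r, 0 <= r <= s -> 0 <= r ^ 3 < 1 / 5).
{ intros r Hr. pose proof (pow_le r 3 ltac:(lra)).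
  pose proof (pow_incr r s 3 Hr). lra. }
pose proof (proj1 Hs) as Hs1.
apply is_series_coef_harmonic with (Z := fun r => r ^ 3 / 2) (U := fun r => 2 * r - r ^ 4)
  (dU := fun r => 2 - 4 * r ^ 3) (z0 := s ^ 3 / 2) (M := 2);
  try (intros r Hr; pose proof (Hr3 r ltac:(lra))).
- lra.
- lra.
- apply lagr_trib, Hs.
- apply coef_gf_trib, Hs.
- pose proof (pow_lt r 3 ltac:(lra)). lra.
- unfold lagr. field.
- auto_derive; [trivial|ring].
- lra.
- ring.
- rewrite (trib_pow4 s Hs). ring.
- eexists. unfold prim3. auto_derive; [|reflexivity].
  split; [apply (pow_nonzero (1 + - (2 * r ^ 3)) 3)|split; [|trivial]]; lra.
- intros HU. unfold prim3, coef_gf. auto_derive.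
  + split; [apply (pow_nonzero (1 + - (2 * r ^ 3)) 3)|split; [|trivial]]; lra.
  + field. repeat split; lra.
- unfold prim3. rewrite Rminus_0_r, ln_1. field.
Qed.

Lemma is_series_coef_H4 s : trib s ->
  is_series (fun k => coef k * harmonic (4 * k)) (prim4 s).
Proof.
intros Hs. pose proof (trib_half_cube s Hs) as Hz.
pose proof (trib_pow4 s Hs) as H4.
pose proof (proj1 Hs) as Hs1.
assert (Hr4 : forall r, 0 <= r <= s -> 0 <= r ^ 4 < 1 / 11).
{ intros r Hr. pose proof (pow_le r 4 ltac:(lra)).
  pose proof (pow_incr r s 4 Hr). lra. }
apply is_series_coef_harmonic with (Z := fun r => r ^ 4 / (1 + r ^ 4))
  (U := fun r => 2 * r / (1 + r ^ 4))
  (dU := fun r => 2 * (1 - 3 * r ^ 4) / (1 + r ^ 4) ^ 2) (z0 := s ^ 3 / 2) (M := 2);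
  try (intros r Hr; pose proof (Hr4 r ltac:(lra))).
- lra.
- lra.
- apply lagr_trib, Hs.
- apply coef_gf_trib, Hs.
- pose proof (pow_lt r 4 ltac:(lra)).
  split; [apply Rdiv_lt_0_compat; lra|apply Rlt_div_l; lra].
- unfold lagr. field. lra.
- auto_derive; [lra|field; lra].
- assert (1 <= (1 + r ^ 4) ^ 2) by nra.
  split; [apply Rdiv_lt_0_compat; nra|apply Rle_div_l; nra].
- field.
- rewrite H4. field. lra.
- eexists. unfold prim4. auto_derive; [|reflexivity].
  split; [apply (pole_nonzero (r ^ 4))|repeat split]; simpl in *; lra.
- intros HU. unfold prim4, coef_gf.
  assert (HU' : 2 * r < 1 + r ^ 4) by (apply Rlt_div_l in HU; lra).
  auto_derive.
  + split; [apply (pole_nonzero (r ^ 4))|repeat split]; simpl in *; lra.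
  + field. repeat split; lra.
- unfold prim4. rewrite Rminus_0_r, (pow_i 4), Rplus_0_r, ln_1 by lia. field.
Qed.

(** * Evaluation *)

(** The parts of the summand free of harmonic numbers are summed at
    [z = s^3 / 2]; the terms [k = 0] of the series starting at [0] account for
    the [- 1].  The logarithm is [- 4 ln (1 - z)] with [1 - z = 1 / (2 s)]. *)
Lemma is_series_assemble (s : R) (m : nat) (t a b c : R) :
  trib s -> is_series (fun k => coef k * harmonic (m * k)) t ->
  is_series_from_1
    (fun k => weight k * (P (INR k) * harmonic (m * k) + a * INR k + b + c / INR k))
    (t + a * (2 * s ^ 3 * (1 - s ^ 3 / 2) / (1 - 2 * s ^ 3) ^ 3)
     + b * (/ (1 - 2 * s ^ 3) - 1) + c * (4 * (ln 2 + ln s))).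
Proof.
intros Hs Ht. pose proof (trib_half_cube s Hs) as Hz.
pose proof (lagr_trib s Hs) as H16. pose proof (trib_pow4 s Hs) as H4.
pose proof (proj1 Hs) as Hs1.
set (z := s ^ 3 / 2) in *.
assert (Hs3 : s ^ 3 = 2 * z) by (unfold z; field).
assert (Hln : - 4 * ln (1 - z) = 4 * (ln 2 + ln s)).
{ rewrite <- ln_mult by lra.
  replace (1 - z) with (/ (2 * s)).
  - rewrite ln_Rinv by lra. ring.
  - apply Rmult_eq_reg_l with (2 * s); [|lra]. rewrite Rinv_r by lra.
    unfold z. lra. }
rewrite Hs3, <- Hln. unfold is_series_from_1.
assert (H1 : is_series (fun k => INR k * weight k) (4 * z * (1 - z) / (1 - 4 * z) ^ 3)).
{ apply (is_series_eq (fun k => INR k * binom4 k * lagr z ^ k) _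
    (4 * z * (1 - z) / (1 - 4 * z) ^ 3)); [|reflexivity|apply is_series_binom4_mul, Hz].
  intros k. rewrite (weight_binom4 z k H16). ring. }
assert (H0 : is_series weight (/ (1 - 4 * z))).
{ apply (is_series_eq (fun k => binom4 k * lagr z ^ k) _ (/ (1 - 4 * z)));
    [|reflexivity|apply is_series_binom4; lra].
  intros k. rewrite (weight_binom4 z k H16). ring. }
assert (w0 : weight 0 = 1) by (unfold weight, Binomial.C; simpl; field).
apply (is_series_eq (fun k => coef (S k) * harmonic (m * S k)
  + a * (INR (S k) * weight (S k)) + b * weight (S k)
  + c * (binom4 (S k) / INR (S k) * lagr z ^ S k)) _
  (t + a * (4 * z * (1 - z) / (1 - 4 * z) ^ 3) + b * (/ (1 - 4 * z) - 1)
   + c * (- 4 * ln (1 - z)))).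
- intros k. rewrite (weight_binom4 z (S k) H16). unfold coef.
  rewrite (weight_binom4 z (S k) H16). field. apply not_0_INR. lia.
- field. lra.
- repeat apply is_series_plusR; try apply is_series_scalR.
  + apply (is_series_shift (fun k => coef k * harmonic (m * k))).
    rewrite Nat.mul_0_r. replace (harmonic 0) with 0.
    * rewrite Rmult_0_r, Rplus_0_l. exact Ht.
    * unfold harmonic. rewrite sum_n_m_zero by lia. reflexivity.
  + apply (is_series_shift (fun k => INR k * weight k)).
    simpl INR. rewrite Rmult_0_l, Rplus_0_l. exact H1.
  + apply (is_series_shift weight). rewrite w0.
    replace (1 + _) with (/ (1 - 4 * z)) by ring. exact H0.
  + apply is_series_binom4_div, Hz.
Qed.

(** [(1 - s)^3 = 2 s^5]: the prime [2] is totally ramified in the field of [s],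
    and this is the resulting relation with the unit [s]. *)
Lemma ln_trib s : trib s -> ln (1 - s) = (ln 2 + 5 * ln s) / 3.
Proof.
intros [Hs H].
assert (H3 : ln ((1 - s) ^ 3) = ln (2 * s ^ 5)).
{ f_equal. replace (2 * s ^ 5) with (2 * s ^ 2 * s ^ 3) by ring.
  rewrite H. ring [H]. }
rewrite ln_mult, !ln_pow in H3 by (try apply pow_lt; lra).
simpl INR in H3. lra.
Qed.

(** [1 - s^3 = s (1 + s) = (1 - s) / s]. *)
Lemma ln_trib_cube s : trib s -> ln (1 - s ^ 3) = (ln 2 + 2 * ln s) / 3.
Proof.
intros Hs. pose proof (ln_trib s Hs) as Hl. destruct Hs as [Hs H].
replace (1 - s ^ 3) with ((1 - s) / s).
- rewrite ln_div by lra. lra.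
- field_simplify_eq; [|lra]. ring [H].
Qed.

(** [1 - s^2 = ((1 - s) / s)^2], since [(1 - s) = s^2 (1 + s)]. *)
Lemma ln_trib_square s : trib s -> ln (1 - s ^ 2) = (2 * ln 2 + 4 * ln s) / 3.
Proof.
intros Hs. pose proof (ln_trib s Hs) as Hl. destruct Hs as [Hs H].
replace (1 - s ^ 2) with (((1 - s) / s) ^ 2).
- rewrite ln_pow by (apply Rdiv_lt_0_compat; lra).
  rewrite ln_div by lra. simpl INR. lra.
- field_simplify_eq; [|lra]. ring [H].
Qed.

Lemma ln_trib_pow4 s : trib s -> ln (1 + s ^ 4) = ln 2 + ln s.
Proof.
intros Hs. rewrite (trib_pow4 s Hs). destruct Hs as [Hs _].
rewrite <- ln_mult by lra. f_equal. ring.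
Qed.

Theorem theorem1p1 :
  is_series_from_1
    (fun k => weight k *
      (P (INR k) * harmonic k - 54 * INR k + 108 - 10 / (3 * INR k)))
    (- (20 / 3) * ln 2) /\
  is_series_from_1
    (fun k => weight k *
      (P (INR k) * harmonic (2 * k) + 287 * INR k - 115 - 25 / (6 * INR k)))
    (214 - 40 / 3 * ln 2) /\
  is_series_from_1
    (fun k => weight k *
      (P (INR k) * harmonic (3 * k) - 296 * INR k + 178 - 25 / (3 * INR k)))
    (- 196 - 80 / 3 * ln 2) /\
  is_series_from_1
    (fun k => weight k *
      (P (INR k) * harmonic (4 * k) - (449 * INR k - 275) / 2
        - 85 / (12 * INR k)))
    (- 151 - 80 / 3 * ln 2).
Proof.
destruct trib_exists as [s Hs].
pose proof (ln_trib s Hs) as L1. pose proof (ln_trib_square s Hs) as L2.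
pose proof (ln_trib_cube s Hs) as L3. pose proof (ln_trib_pow4 s Hs) as L4.
pose proof (trib_half_cube s Hs) as Hz. pose proof (proj2 Hs) as H.
pose proof (trib_pow4 s Hs) as H4. pose proof (proj1 Hs) as Hs1.
(* In each case the value is compared with the claimed one by [field [H]]:
   after the logarithms are expressed through [ln 2] and [ln s], it is an
   identity between rational functions of [s] modulo the cubic [H]. *)
assert (nz : forall k, INR (S k) <> 0) by (intros; apply not_0_INR; lia).
repeat split.
- pose proof (is_series_assemble s 1 _ (- 54) 108 (- (10 / 3)) Hs (is_series_coef_H1 s Hs)) as F.
  revert F. apply is_series_eq.
  + intros k. rewrite Nat.mul_1_l. field. apply nz.
  + unfold prim1. replace (1 - 2 * (s ^ 3 / 2)) with (1 - s ^ 3) by field.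
    rewrite L3. field [H]. lra.
- pose proof (is_series_assemble s 2 _ 287 (- 115) (- (25 / 6)) Hs (is_series_coef_H2 s Hs)) as F.
  revert F. apply is_series_eq.
  + intros k. field. apply nz.
  + unfold prim2. rewrite L2. replace (1 + (s ^ 2) ^ 2) with (1 + s ^ 4) by ring. rewrite L4.
    field [H]. repeat split; lra.
- pose proof (is_series_assemble s 3 _ (- 296) 178 (- (25 / 3)) Hs (is_series_coef_H3 s Hs)) as F.
  revert F. apply is_series_eq.
  + intros k. field. apply nz.
  + unfold prim3. rewrite L1. field [H]. lra.
- pose proof (is_series_assemble s 4 _ (- (449 / 2)) (275 / 2) (- (85 / 12)) Hs (is_series_coef_H4 s Hs)) as F.
  revert F. apply is_series_eq.
  + intros k. field. apply nz.
  + unfold prim4. rewrite L1, L4. field [H]. repeat split; lra.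
Qed.
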